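(* Let $r=\langle L\leftarrow K\rightarrow R\rangle$ be a rule and let $r\!\downarrow=\langle L\leftarrow K'\rightarrow R\rangle$ be its normal form, where $K'=(V_K,\emptyset,\emptyset,\emptyset,\emptyset,\emptyset,\emptyset)$ is the graph with node set $V_K$, no edges, no node labels and undefined rootedness everywhere. Then for all TLRGs $G,H$: $G\Rightarrow_r H$ if and only if $G\Rightarrow_{r\downarrow} H$.
   Context: Fix a label alphabet $\mathcal{L}=(\mathcal{L}_V,\mathcal{L}_E)$ of finite sets. A graph over $\mathcal{L}$ is $G=(V,E,s,t,l,m,p)$ with finite $V,E$, total $s,t:E\to V$, partial node labelling $l:V\to\mathcal{L}_V$, total edge labelling $m:E\to\mathcal{L}_E$, partial rootedness $p:V\to\{0,1\}$ ($1$ = root). A TLRG is a graph with $l,p$ total. A morphism is a pair $(g_V,g_E)$ preserving sources, targets, edge labels, node labels where defined in the domain and rootedness where defined in the domain. $K$ is a subgraph of $G$ iff $V_K\subseteq V_G$, $E_K\subseteq E_G$, structure and edge labels are restrictions, $l_K\subseteq l_G$, $p_K\subseteq p_G$. A rule $\langle L\leftarrow K\rightarrow R\rangle$: TLRGs $L,R$ and a graph $K$ that is a subgraph of both. For a TLRG $G$ and injective $g:L\to G$ satisfying the dangling condition (no edge of $G$ outside $g(L)$ is incident to a node of $g(V_L\setminus V_K)$): delete the images of the nodes and edges of $L$ not in $K$; for $v\in V_K$ unlabelled (resp. of undefined rootedness) in $K$ make $g_V(v)$ unlabelled (resp. of undefined rootedness), giving $D$; add disjointly the nodes and edges of $R$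 not in $K$ with their labels and rootedness and give each such $g_V(v)$ label $l_R(v)$ (resp. rootedness $p_R(v)$), giving $H$. $G\Rightarrow_r M$ means $M\cong H$ for some such application. *)

(* Defs.v *)
From mathcomp Require Import all_boot.

Set Implicit Arguments.
Unset Strict Implicit.
Unset Printing Implicit Defensive.

(* Graphs over the label alphabet (LV, LE).  Partial functions are
   option-valued; [Some true] is a root and [Some false] a non-root. *)
Record graph (LV LE : finType) : Type := Graph {
  node : finType;
  edge : finType;
  src : edge -> node;
  tgt : edge -> node;
  lab : node -> option LV;
  elab : edge -> LE;
  rooted : node -> option bool
}.

Arguments src {LV LE g} _.
Arguments tgt {LV LE g} _.
Arguments lab {LV LE g} _.
Arguments elab {LV LE g} _.
Arguments rooted {LV LE g} _.

(* Totally labelled rooted graphs. *)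
Definition tlrg (LV LE : finType) (G : graph LV LE) : Prop :=
  (forall v : node G, lab v <> None) /\ (forall v : node G, rooted v <> None).

Record morphism (LV LE : finType) (G H : graph LV LE) : Type := Morphism {
  mapV : node G -> node H;
  mapE : edge G -> edge H;
  map_src : forall e : edge G, src (mapE e) = mapV (src e);
  map_tgt : forall e : edge G, tgt (mapE e) = mapV (tgt e);
  map_elab : forall e : edge G, elab (mapE e) = elab e;
  map_lab : forall (v : node G) (a : LV),
    lab v = Some a -> lab (mapV v) = Some a;
  map_rooted : forall (v : node G) (b : bool),
    rooted v = Some b -> rooted (mapV v) = Some b
}.

Definition isomorphic (LV LE : finType) (G H : graph LV LE) : Prop :=
  exists (f : morphism G H) (f' : morphism H G),
    [/\ cancel (mapV f) (mapV f'), cancel (mapV f') (mapV f),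
        cancel (mapE f) (mapE f') & cancel (mapE f') (mapE f)].

(* Injective morphisms.  An embedding of K into G presents K as a subgraph of
   G: sources, targets and edge labels of K are restrictions of those of G,
   and its node labelling and rootedness are included in those of G. *)
Record embedding (LV LE : finType) (K G : graph LV LE) : Type := Embedding {
  emb :> morphism K G;
  embV_inj : injective (mapV emb);
  embE_inj : injective (mapE emb)
}.

Record rule (LV LE : finType) : Type := Rule {
  lhs : graph LV LE;
  interface : graph LV LE;
  rhs : graph LV LE;
  lhs_tlrg : tlrg lhs;
  rhs_tlrg : tlrg rhs;
  inL : embedding interface lhs;
  inR : embedding interface rhs
}.

Section Application.

Variables (LV LE : finType) (r : rule LV LE) (G : graph LV LE).

Let L := lhs r.
Let K := interface r.
Let R := rhs r.

Section Deletion.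

Variable g : morphism L G.

Definition deleted_nodes : {set node G} :=
  mapV g @: [set x : node L | x \notin codom (mapV (inL r))].

Definition deleted_edges : {set edge G} :=
  mapE g @: [set x : edge L | x \notin codom (mapE (inL r))].

Definition dangling_condition : Prop :=
  forall e : edge G, e \notin codom (mapE g) ->
    src e \notin deleted_nodes /\ tgt e \notin deleted_nodes.

End Deletion.

Record rule_match : Type := RuleMatch {
  match_emb :> embedding L G;
  match_dangling : dangling_condition match_emb
}.

Variable g : rule_match.

Let gV : node L -> node G := mapV g.
Let kV : node K -> node L := mapV (inL r).

Lemma interface_kept (k : node K) : gV (kV k) \notin deleted_nodes g.
Proof.
apply/negP => /imsetP[x]; rewrite inE => xNK /(@embV_inj _ _ _ _ g) kx.
by rewrite -kx codom_f in xNK.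
Qed.

Lemma src_kept (e : edge G) :
  e \notin deleted_edges g -> src e \notin deleted_nodes g.
Proof.
case: (boolP (e \in codom (mapE g))) => [/codomP[x ->] xkept|eNg _].
  have /codomP[y ->] : x \in codom (mapE (inL r)).
    by apply: contraR xkept => xNK; rewrite imset_f // inE.
  by rewrite !map_src interface_kept.
by case: (match_dangling eNg).
Qed.

Lemma tgt_kept (e : edge G) :
  e \notin deleted_edges g -> tgt e \notin deleted_nodes g.
Proof.
case: (boolP (e \in codom (mapE g))) => [/codomP[x ->] xkept|eNg _].
  have /codomP[y ->] : x \in codom (mapE (inL r)).
    by apply: contraR xkept => xNK; rewrite imset_f // inE.
  by rewrite !map_tgt interface_kept.
by case: (match_dangling eNg).
Qed.

Definition kept_node : finType := {v : node G | v \notin deleted_nodes g}.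
Definition kept_edge : finType := {e : edge G | e \notin deleted_edges g}.

(* The interface node, unlabelled (resp. of undefined rootedness) in K, whose
   image is v, if there is one; it is unique since g and K -> L are
   injective. *)
Definition unlabelled_preimage (v : node G) : option (node K) :=
  [pick k | (gV (kV k) == v) && (lab k == None)].
Definition unrooted_preimage (v : node G) : option (node K) :=
  [pick k | (gV (kV k) == v) && (rooted k == None)].

(* The intermediate graph D. *)
Definition context_graph : graph LV LE := {|
  node := kept_node;
  edge := kept_edge;
  src := fun e => exist _ (src (val e)) (src_kept (valP e));
  tgt := fun e => exist _ (tgt (val e)) (tgt_kept (valP e));
  lab := fun v => if unlabelled_preimage (val v) is Some _ then None
                  else lab (val v);
  elab := fun e => elab (val e);
  rooted := fun v => if unrooted_preimage (val v) is Some _ then None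
                     else rooted (val v)
|}.

Definition new_node : finType := {v : node R | v \notin codom (mapV (inR r))}.
Definition new_edge : finType := {e : edge R | e \notin codom (mapE (inR r))}.

Definition interface_or_new (v : node R) :
  {k : node K | mapV (inR r) k = v} + {v \notin codom (mapV (inR r))}.
Proof.
case: (boolP (v \in codom (mapV (inR r)))) => [vK | vNK]; last by right.
by left; exists (iinv vK); rewrite f_iinv.
Defined.

(* A node of R, as a node of the result: nodes of K are identified with their
   image in G, the others are the newly added ones. *)
Definition comatch_node (v : node R) : node context_graph + new_node :=
  match interface_or_new v with
  | inleft kv => inl (exist _ (gV (kV (sval kv))) (interface_kept (sval kv)))
  | inright vNK => inr (exist _ v vNK)
  end.

(* The result H of applying r at g. *)
Definition result_graph : graph LV LE := {|
  node := (node context_graph + new_node)%type;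
  edge := (edge context_graph + new_edge)%type;
  src := fun e => match e with
                  | inl d => inl (src d)
                  | inr n => comatch_node (src (val n))
                  end;
  tgt := fun e => match e with
                  | inl d => inl (tgt d)
                  | inr n => comatch_node (tgt (val n))
                  end;
  lab := fun v => match v with
                  | inl d => if unlabelled_preimage (val d) is Some k
                             then lab (mapV (inR r) k) else lab d
                  | inr n => lab (val n)
                  end;
  elab := fun e => match e with
                   | inl d => elab d
                   | inr n => elab (val n)
                   end;
  rooted := fun v => match v with
                     | inl d => if unrooted_preimage (val d) is Some k
                                then rooted (mapV (inR r) k) else rooted d
                     | inr n => rooted (val n)
                     end
|}.

End Application.

Definition derives (LV LE : finType) (r : rule LV LE) (G M : graph LV LE) :
    Prop :=
  exists g : rule_match r G, isomorphic M (result_graph g).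

Section NormalForm.

Variables LV LE : finType.

Definition discrete_graph (V : finType) : graph LV LE := {|
  node := V;
  edge := void;
  src := fun e => match e with end;
  tgt := fun e => match e with end;
  lab := fun _ => None;
  elab := fun e => match e with end;
  rooted := fun _ => None
|}.

Definition discrete_morphism (K G : graph LV LE) (f : morphism K G) :
    morphism (discrete_graph (node K)) G.
Proof.
refine {| mapV := mapV f : node (discrete_graph (node K)) -> node G;
          mapE := fun e : edge (discrete_graph (node K)) =>
                    match e with end |}; by [case | ].
Defined.

Definition discrete_embedding (K G : graph LV LE) (f : embedding K G) :
    embedding (discrete_graph (node K)) G.
Proof.
exists (discrete_morphism f); [exact: (@embV_inj _ _ _ _ f) | by case].
Defined.

Definition normal_form (r : rule LV LE) : rule LV LE := {|
  lhs := lhs r;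
  interface := discrete_graph (node (interface r));
  rhs := rhs r;
  lhs_tlrg := lhs_tlrg r;
  rhs_tlrg := rhs_tlrg r;
  inL := discrete_embedding (inL r);
  inR := discrete_embedding (inR r)
|}.

End NormalForm.

(* Main.v *)
Require Import Defs.
From mathcomp Require Import all_boot.

(** Both rules have the same matches, since deleted nodes depend only on the
    nodes of the interface, and the nodes of the two results coincide.  The
    difference is that [r] keeps the images of the interface edges, whereas its
    normal form deletes them and adds them again as edges of the right-hand
    side; sending the edges re-added by the normal form back to the ones kept by
    [r] is the required isomorphism.  A node labelled in the interface has the
    same label in L and in R, so relabelling it changes nothing. *)

Set Implicit Arguments.
Unset Strict Implicit.
Unset Printing Implicit Defensive.

Lemma inj_surj_bij (A B : finType) (f : A -> B) :
  injective f -> (forall y, exists x, f x = y) -> bijective f.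
Proof.
move=> f_inj f_surj.
have f_codom y : y \in codom f by case: (f_surj y) => x <-; exact: codom_f.
exists (fun y => iinv (f_codom y)) => [x|y]; last exact: f_iinv.
by apply: f_inj; rewrite f_iinv.
Qed.

Section Isomorphism.

Variables LV LE : finType.
Implicit Types A B C : graph LV LE.

(** Morphisms only preserve labels and rootedness where defined; equality of the optional values is
    what makes the inverse maps a morphism as well. *)
Lemma isomorphic_bij A B (fV : node A -> node B) (fE : edge A -> edge B) :
    bijective fV -> bijective fE ->
    (forall e, src (fE e) = fV (src e)) ->
    (forall e, tgt (fE e) = fV (tgt e)) ->
    (forall e, elab (fE e) = elab e) ->
    (forall v, lab (fV v) = lab v) ->
    (forall v, rooted (fV v) = rooted v) ->
  isomorphic A B.
Proof.
move=> [fV' fVK fVK'] [fE' fEK fEK'] fsrc ftgt felab flab froot.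
unshelve eexists (@Morphism _ _ A B fV fE fsrc ftgt felab _ _).
- by move=> v a; rewrite flab.
- by move=> v b; rewrite froot.
unshelve eexists (@Morphism _ _ B A fV' fE' _ _ _ _ _) => //.
- by move=> e; rewrite -{2}[e]fEK' fsrc fVK.
- by move=> e; rewrite -{2}[e]fEK' ftgt fVK.
- by move=> e; rewrite -{2}[e]fEK' felab.
- by move=> v a; rewrite -{1}[v]fVK' flab.
- by move=> v b; rewrite -{1}[v]fVK' froot.
Qed.

Lemma isomorphic_sym A B : isomorphic A B -> isomorphic B A.
Proof. by move=> [f [f' [? ? ? ?]]]; exists f', f. Qed.

Lemma isomorphic_trans A B C :
  isomorphic A B -> isomorphic B C -> isomorphic A C.
Proof.
have comp (X Y Z : graph LV LE) (f : morphism X Y) (h : morphism Y Z) :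
    {k : morphism X Z | mapV k = mapV h \o mapV f & mapE k = mapE h \o mapE f}.
  unshelve eexists (@Morphism _ _ X Z (mapV h \o mapV f) (mapE h \o mapE f)
    _ _ _ _ _) => //=.
  - by move=> e; rewrite !map_src.
  - by move=> e; rewrite !map_tgt.
  - by move=> e; rewrite !map_elab.
  - by move=> v a /(map_lab f)/(map_lab h).
  - by move=> v b /(map_rooted f)/(map_rooted h).
move=> [f [f' [fVK fVK' fEK fEK']]] [h [h' [hVK hVK' hEK hEK']]].
have [k kV kE] := comp _ _ _ f h; have [k' kV' kE'] := comp _ _ _ h' f'.
by exists k, k'; rewrite kV kE kV' kE'; split; apply: can_comp.
Qed.

End Isomorphism.

Section NormalFormResult.

Variables (LV LE : finType) (r : rule LV LE) (G : graph LV LE).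

(** [deleted_nodes] for [normal_form r] is convertible to that for [r], so the dangling proof
    carries over unchanged. *)
Definition normal_match (g : rule_match r G) : rule_match (normal_form r) G :=
  @RuleMatch _ _ (normal_form r) G (match_emb g) (@match_dangling _ _ _ _ g).

Variable g : rule_match r G.

Let L := lhs r.
Let K := interface r.
Let R := rhs r.
Let g' := normal_match g.

Lemma interface_edge_kept (k : edge K) :
  mapE g (mapE (inL r) k) \notin deleted_edges g.
Proof.
apply/negP => /imsetP[x]; rewrite inE => xNK /(@embE_inj _ _ _ _ g) kx.
by rewrite -kx codom_f in xNK.
Qed.

(** The interface of the normal form has no edges, so no matched edge can be kept. *)
Lemma match_edge_deleted_normal_form (x : edge L) :
  mapE g x \in deleted_edges g'.
Proof. by apply: imset_f; rewrite inE; apply/negP => /codomP[[]]. Qed.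

Lemma kept_edge_normal_form (e : kept_edge g') :
  val e \notin deleted_edges g.
Proof.
apply: contra (valP e) => /imsetP[x _ ->].
exact: match_edge_deleted_normal_form.
Qed.

Lemma comatch_node_interface (k : node K) :
  comatch_node g (mapV (inR r) k) =
    inl (exist _ (mapV g (mapV (inL r) k)) (interface_kept g k)).
Proof.
rewrite /comatch_node; case: interface_or_new => [[k' /= kk']|]; last first.
  by move=> kN; case/negP: (kN); exact: codom_f.
by have {kk'} -> := embV_inj kk'; congr inl; apply: val_inj.
Qed.

(** The edge part of the comatch from R into the result of [r], parallel to [comatch_node]. *)
Definition comatch_edge (e : edge R) : edge (result_graph g) :=
  match boolP (e \in codom (mapE (inR r))) with
  | AltTrue eK =>
      inl (exist _ (mapE g (mapE (inL r) (iinv eK))) (interface_edge_kept _))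
  | AltFalse eN => inr (exist _ e eN)
  end.

(** Case analysis through this predicate hides the chosen preimage [iinv] and its membership
    proof. *)
Variant comatch_edge_spec (e : edge R) : edge (result_graph g) -> Type :=
| ComatchInterface k of e = mapE (inR r) k :
    comatch_edge_spec e
      (inl (exist _ (mapE g (mapE (inL r) k)) (interface_edge_kept k)))
| ComatchNew (eN : e \notin codom (mapE (inR r))) :
    comatch_edge_spec e (inr (exist _ e eN)).

Lemma comatch_edgeP e : comatch_edge_spec e (comatch_edge e).
Proof.
rewrite /comatch_edge; case: {-}_ / boolP => [eK|eN]; last exact: ComatchNew.
by apply: ComatchInterface; rewrite f_iinv.
Qed.

(* The node types of the two results are convertible. *)
Definition normal_result_node (v : node (result_graph g')) :
  node (result_graph g) := v.

Definition normal_result_edge (e : edge (result_graph g')) :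
  edge (result_graph g) :=
  match e with
  | inl d => inl (exist _ (val d) (kept_edge_normal_form d))
  | inr n => comatch_edge (val n)
  end.

Lemma normal_result_edge_inj : injective normal_result_edge.
Proof.
(* Separates the two summands: a re-added edge goes to a matched edge or to a new one, never to an
   unmatched edge of G. *)
have kept_neq (d : kept_edge g') x : val d <> mapE g x.
  move=> dx; have := match_edge_deleted_normal_form x.
  by rewrite -dx; apply/negP/(valP d).
move=> [d1|n1] [d2|n2] /=.
- by move=> [d12]; congr inl; apply: val_inj.
- by case: comatch_edgeP => // k _ [/kept_neq].
- by case: comatch_edgeP => // k _ [/esym/kept_neq].
move=> n12; congr inr; apply: val_inj; move: n12.
case: comatch_edgeP => [k1 n1k|e1N]; case: comatch_edgeP => [k2 n2k|e2N] //.
  by case=> /(@embE_inj _ _ _ _ g)/embE_inj k12; rewrite k12 -n2k in n1k.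
by case.
Qed.

Lemma normal_result_edge_surj y : exists x, normal_result_edge x = y.
Proof.
have newP (e : edge R) : e \notin codom (mapE (inR (normal_form r))).
  by apply/negP => /codomP[[]].
case: y => [[d dkept]|[n nN]]; last first.
  exists (inr (exist _ n (newP n))) => /=.
  case: comatch_edgeP => [k nk|eN]; first by case/negP: (nN); rewrite nk codom_f.
  by congr inr; apply: val_inj.
case: (boolP (d \in codom (mapE g))) => [/codomP[x dx]|dNg]; last first.
  have d' : d \notin deleted_edges g'.
    by apply: contra dNg => /imsetP[x _ ->]; exact: codom_f.
  by exists (inl (exist _ d d')); congr inl; apply: val_inj.
(* A matched edge that [r] keeps comes from an interface edge [k]; the copy of [k] in R, re-added by
   the normal form, is its preimage. *)
have /codomP[k xk] : x \in codom (mapE (inL r)).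
  by apply: contraR dkept => xNK; rewrite dx imset_f // inE.
exists (inr (exist _ (mapE (inR r) k) (newP _))) => /=.
case: comatch_edgeP => [k' /embE_inj <-|kN]; last first.
  by case/negP: (kN); exact: codom_f.
by congr inl; apply: val_inj; rewrite /= dx xk.
Qed.

Lemma comatch_node_normal_form v :
  comatch_node g v = normal_result_node (comatch_node g' v).
Proof.
rewrite /comatch_node.
case: interface_or_new => [[k kv]|vN];
  case: (interface_or_new (r := normal_form r)) => [[k' kv']|vN'] //=.
- congr inl; apply: val_inj => /=.
  by have -> : k = k' by apply: (@embV_inj _ _ _ _ (inR r)); rewrite kv.
- by case/negP: (vN'); rewrite -kv; exact: codom_f.
- by case/negP: (vN); rewrite -kv'; exact: codom_f.
by congr inr; apply: val_inj.
Qed.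

Lemma normal_result_src e :
  src (normal_result_edge e) = normal_result_node (src e).
Proof.
case: e => [d|n] /=; first by congr inl; apply: val_inj.
rewrite -comatch_node_normal_form.
case: comatch_edgeP => [k ->|//]; rewrite map_src comatch_node_interface.
by congr inl; apply: val_inj; rewrite /= !map_src.
Qed.

Lemma normal_result_tgt e :
  tgt (normal_result_edge e) = normal_result_node (tgt e).
Proof.
case: e => [d|n] /=; first by congr inl; apply: val_inj.
rewrite -comatch_node_normal_form.
case: comatch_edgeP => [k ->|//]; rewrite map_tgt comatch_node_interface.
by congr inl; apply: val_inj; rewrite /= !map_tgt.
Qed.

Lemma normal_result_elab e : elab (normal_result_edge e) = elab e.
Proof.
by case: e => [d|n] //=; case: comatch_edgeP => [k ->|//] /=; rewrite !map_elab.
Qed.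

Lemma match_interface_inj : injective (mapV g \o mapV (inL r)).
Proof. by apply: inj_comp; exact: embV_inj. Qed.

Lemma normal_result_lab v : lab (normal_result_node v) = lab v.
Proof.
case: v => [d|//]; rewrite /= /unlabelled_preimage /=.
case: pickP => [k /andP[/eqP kd _]|noK];
  case: pickP => [k' /andP[/eqP kd' _]|noK'] //.
- by have -> : k = k' by apply: match_interface_inj; rewrite /= kd.
- by have := noK' k; rewrite /= kd !eqxx.
(* Here [k'] is labelled in K: [r] keeps the label from G while the normal form takes the one from
   R. Both equal [a], since K -> R and K -> L -> G preserve defined labels. *)
have := noK k'; rewrite kd' eqxx /=; case ak: (lab k') => [a|//] _.
by rewrite -kd' (map_lab (inR r) ak) (map_lab g (map_lab (inL r) ak)).
Qed.

Lemma normal_result_rooted v : rooted (normal_result_node v) = rooted v.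
Proof.
case: v => [d|//]; rewrite /= /unrooted_preimage /=.
case: pickP => [k /andP[/eqP kd _]|noK];
  case: pickP => [k' /andP[/eqP kd' _]|noK'] //.
- by have -> : k = k' by apply: match_interface_inj; rewrite /= kd.
- by have := noK' k; rewrite /= kd !eqxx.
have := noK k'; rewrite kd' eqxx /=; case bk: (rooted k') => [b|//] _.
by rewrite -kd' (map_rooted (inR r) bk) (map_rooted g (map_rooted (inL r) bk)).
Qed.

Lemma normal_result_isomorphic : isomorphic (result_graph g') (result_graph g).
Proof.
apply: (isomorphic_bij (fV := normal_result_node) (fE := normal_result_edge)).
(* The node map is the identity up to conversion, hence its own inverse. *)
- by exists normal_result_node.
- exact: inj_surj_bij normal_result_edge_inj normal_result_edge_surj.
- exact: normal_result_src.
- exact: normal_result_tgt.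
- exact: normal_result_elab.
- exact: normal_result_lab.
- exact: normal_result_rooted.
Qed.

End NormalFormResult.

Unset Implicit Arguments.

Theorem mainTheorem3 (LV LE : finType) (r : rule LV LE) (G H : graph LV LE)
    (hG : tlrg G) (hH : tlrg H) :
  derives r G H <-> derives (normal_form r) G H.
Proof.
split=> [[g isoH]|[[g dang] isoH]].
  exists (normal_match g); apply: isomorphic_trans isoH _.
  exact/isomorphic_sym/normal_result_isomorphic.
(* The same embedding and dangling proof also form a match of [r], and [normal_match] sends it back
   to the given match by conversion. *)
exists (@RuleMatch _ _ r G g dang); apply: isomorphic_trans isoH _.
exact: (normal_result_isomorphic (@RuleMatch _ _ r G g dang)).
Qed.
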